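(* Every locally finite quasi-transitive hyperbolic graph is accessible.
   Context: A graph $G$ is quasi-transitive if its automorphism group has only finitely many orbits on the vertex set $V(G)$. For $\delta\in\mathbb N$, a graph $G$ is $\delta$-hyperbolic if it is connected and if for any three vertices and any three shortest paths $P_1,P_2,P_3$, one between any two of the three vertices, every vertex on $P_1$ has distance at most $\delta$ to some vertex on $P_2$ or $P_3$. A graph is hyperbolic if it is $\delta$-hyperbolic for some $\delta\in\mathbb N$. A ray is a one-way infinite path. Two rays are equivalent if, for every finite edge set $F\subseteq E(G)$, they lie eventually in the same component of $G-F$. The equivalence classes are the (edge) ends of $G$. An edge set $F\subseteq E(G)$ separates two ends if the rays of these ends lie eventually in different components of $G-F$. A graph $G$ is accessible if there exists $k\in\mathbb N$ such that any two distinct ends of $G$ can be separated by at most $k$ edges. *)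

(* Defs.v *)
From HB Require Import structures.
From mathcomp Require Import all_boot.
From mathcomp Require Import boolp classical_sets functions cardinality.

Set Implicit Arguments.
Unset Strict Implicit.
Unset Printing Implicit Defensive.

Local Open Scope classical_set_scope.

(* Simple undirected graphs, possibly infinite. *)
Record graph := Graph {
  vertex :> choiceType;
  adj : rel vertex;
  adj_sym : symmetric adj;
  adj_irr : irreflexive adj
}.

(* An edge is the unordered pair of its end vertices. *)
Definition edges (G : graph) : set (set G) :=
  [set e | exists x y : G, adj x y /\ e = [set x; y]].
Arguments edges : clear implicits.

Section DeleteEdges.
Variables (G : graph) (F : set (set G)).

Definition del_adj : rel G := fun x y => adj x y && ([set x; y] \notin F).

Fact del_adj_sym : symmetric del_adj.
Proof. by move=> x y; rewrite /del_adj adj_sym setUC. Qed.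

Fact del_adj_irr : irreflexive del_adj.
Proof. by move=> x; rewrite /del_adj adj_irr. Qed.

Definition del_edges : graph := Graph del_adj_sym del_adj_irr.

End DeleteEdges.

Definition locally_finite (G : graph) : Prop :=
  forall x : G, finite_set [set y | adj x y].

Definition automorphism (G : graph) (f : G -> G) : Prop :=
  bijective f /\ forall x y : G, adj (f x) (f y) = adj x y.

Definition aut_orbit (G : graph) (x : G) : set G :=
  [set y | exists2 f : G -> G, automorphism f & y = f x].

Definition quasi_transitive (G : graph) : Prop :=
  finite_set (range (@aut_orbit G)).

(* [x :: p] lists the vertices of the path; [size p] is its length. *)
Definition is_path (G : graph) (x y : G) (p : seq G) : Prop :=
  [/\ path (@adj G) x p, last x p = y & uniq (x :: p)].

Definition is_shortest_path (G : graph) (x y : G) (p : seq G) : Prop :=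
  is_path x y p /\ forall q, is_path x y q -> size p <= size q.

Definition dist_le (G : graph) (x y : G) (d : nat) : Prop :=
  exists2 p, is_shortest_path x y p & size p <= d.

Definition linked (G : graph) (x y : G) : Prop := exists p, is_path x y p.

Definition connected (G : graph) : Prop := forall x y : G, linked x y.

(* Components are represented by their vertex sets. *)
Definition components (G : graph) : set (set G) :=
  range (fun x : G => [set y | linked x y]).
Arguments components : clear implicits.

Definition delta_hyperbolic (delta : nat) (G : graph) : Prop :=
  connected G /\
  forall (x y z : G) (p1 p2 p3 : seq G),
    is_shortest_path x y p1 ->
    is_shortest_path y z p2 ->
    is_shortest_path x z p3 ->
    forall u, u \in x :: p1 ->
      exists2 v, (v \in y :: p2) || (v \in x :: p3) & dist_le u v delta.

Definition hyperbolic (G : graph) : Prop :=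
  exists delta : nat, delta_hyperbolic delta G.

Definition rays (G : graph) : set (nat -> G) :=
  [set r | injective r /\ forall n, adj (r n) (r n.+1)].
Arguments rays : clear implicits.

Definition eventually_in (G : graph) (r : nat -> G) (C : set G) : Prop :=
  exists N, forall n, N <= n -> C (r n).

Definition ray_equiv (G : graph) (r s : nat -> G) : Prop :=
  forall F : set (set G), F `<=` edges G -> finite_set F ->
    exists2 C, components (del_edges F) C &
      eventually_in r C /\ eventually_in s C.

Definition ends (G : graph) : set (set (nat -> G)) :=
  [set w | exists2 r, rays G r & w = [set s | rays G s /\ ray_equiv r s]].
Arguments ends : clear implicits.

Definition separates (G : graph) (F : set (set G)) (w w' : set (nat -> G)) :
    Prop :=
  exists C D : set G,
    [/\ components (del_edges F) C, components (del_edges F) D, C <> D,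
        (forall r, w r -> eventually_in r C) &
        (forall s, w' s -> eventually_in s D)].

Definition accessible (G : graph) : Prop :=
  exists k : nat, forall w w' : set (nat -> G),
    ends G w -> ends G w' -> w <> w' ->
    exists F : set (set G),
      [/\ F `<=` edges G, (F #<= `I_k)%card & separates F w w'].

(* Main.v *)
Require Import Defs.
From mathcomp Require Import all_boot finmap.
From mathcomp Require Import boolp classical_sets functions cardinality fsbigop.
From mathcomp Require Import zify.

(** The proof bounds the set of sizes of minimum cuts between two rays; a
    bound on these sizes is the number of edges that suffices to separate
    any two ends.

    A cut is handled as a vertex set [A] with finite boundary.
    Hyperbolicity enters through a single consequence,
    [outer_coarsely_connected]: if both [A] and its complement are
    connected, then the boundary of [A] cannot be split into two parts that
    are far from each other.  Indeed every closed walk of a hyperbolic graph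
    is a sum modulo 2 of short closed walks; a short closed walk meets at
    most one of two distant parts and meets it evenly, so each part alone
    would be met evenly by all closed walks, whereas some closed walk meets
    a given part exactly once.  In particular only finitely many bonds of
    size at most [n] pass near a given vertex ([finite_bonds_near]).

    Fix [n] and consider, for each pair of rays that have a minimum cut of
    size at most [n], those minimum cuts that are crossed by the fewest
    bonds of size at most [n].  When two such cuts cross, replacing them by
    a suitable pair of opposite corners preserves both minimalities, because
    boundary sizes are submodular, but strictly decreases the total number
    of crossing bonds.  Hence these cuts form a nested family [cuts n] that
    is invariant under automorphisms and closed under complementation, and
    that contains a cut of each minimum cut size up to [n].

    The number of sizes that occur in [cuts n] is bounded independently of
    [n].  The nested family is the edge set of a tree in which the vertices
    of the graph occupy nodes and the edges of the graph trace paths.  Label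
    the cuts by bits that depend only on their size, and view the labels as
    differences of a potential on the nodes of the tree.  Demanding that all
    triples of vertices of bounded diameter have zero potential at their
    median in the tree is a system of linear equations over the field with
    two elements, with one equation for each of the finitely many orbits of
    such triples.  By [weight_eq0] its only solution is zero: a node of
    nonzero potential would be neither the image of a vertex nor a branching
    node of a short cycle, so all edges of the graph that enter this node
    through one tree edge would leave it through one and the same other tree
    edge, which is impossible because cuts in the family have connected
    sides.  So there are at most as many sizes as orbits of triples, which
    is [finitely_many_mincut_sizes]. *)

Set Implicit Arguments.
Unset Strict Implicit.
Unset Printing Implicit Defensive.

Local Open Scope classical_set_scope.

(** * Walks and shortest paths *)

Lemma nat_argmin (T : Type) (P : T -> Prop) (m : T -> nat) x0 : P x0 ->
  exists x, P x /\ forall y, P y -> m x <= m y.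
Proof.
move=> Px0; pose Q n := `[< exists2 x, P x & m x = n >].
have exQ : exists n, Q n by exists (m x0); apply/asboolP; exists x0.
have [n /asboolP[x Px <-] nmin] := ex_minnP exQ.
by exists x; split => // y Py; apply: nmin; apply/asboolP; exists y.
Qed.

Section Walks.
Variable G : graph.
Implicit Types (x y z : G) (p q : seq G).

Definition near (d : nat) x y :=
  exists p, [/\ path (@adj G) x p, last x p = y & size p <= d].

Lemma near0 d x : near d x x.
Proof. by exists [::]. Qed.

Lemma near1 x y : adj x y -> near 1 x y.
Proof. by move=> xy; exists [:: y]; rewrite /= xy. Qed.

Lemma near_trans d e x y z : near d x y -> near e y z -> near (d + e) x z.
Proof.
move=> [p [pp <- sp]] [q [pq <- sq]]; exists (p ++ q).
by rewrite cat_path pp pq last_cat size_cat leq_add.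
Qed.

Lemma near_le d e x y : d <= e -> near d x y -> near e x y.
Proof.
by move=> de [p [? ? sp]]; exists p; split => //; exact: leq_trans de.
Qed.

Lemma path_rev x p :
  path (@adj G) x p -> path (@adj G) (last x p) (rev (belast x p)).
Proof.
rewrite -[in X in X -> _](eq_path (e := fun z => (@adj G)^~ z)) ?rev_path //.
by move=> a b; rewrite adj_sym.
Qed.

Lemma last_rev_belast x p : last (last x p) (rev (belast x p)) = x.
Proof. by case: p => //= y p; rewrite rev_cons last_rcons. Qed.

Lemma near_sym d x y : near d x y -> near d y x.
Proof.
move=> [p [pp <- sp]]; exists (rev (belast x p)).
by rewrite path_rev // last_rev_belast size_rev size_belast.
Qed.

Lemma walk_near d x p u v : path (@adj G) x p -> size p <= d ->
  u \in x :: p -> v \in x :: p -> near d u v.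
Proof.
have dir y q w : path (@adj G) y q -> w \in y :: q -> near (size q) y w.
  move=> + wq; case/splitPl: wq => q1 q2 lq.
  by rewrite cat_path => /andP[? _]; exists q1; rewrite size_cat leq_addr.
elim: p x d => [|y p IH] x d.
  by rewrite !inE => _ _ /eqP-> /eqP->; exact: near0.
move=> pxp sp; have /andP[_ pp] := pxp.
rewrite (in_cons x) => /predU1P[-> vp|up].
  by apply: near_le sp _; apply: (dir x (y :: p)).
rewrite (in_cons x) => /predU1P[->|vp].
  apply: near_le sp _; apply: near_sym; apply: (dir x (y :: p)) => //.
  by rewrite in_cons up orbT.
by apply: IH up vp => //; exact: ltnW.
Qed.

Lemma walk_is_path x p : path (@adj G) x p ->
  exists2 q, is_path x (last x p) q & size q <= size p.
Proof.
move=> pp; case: (shortenP pp) => q pq uq sq; exists q; first by split.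
by apply: uniq_leq_size => //; case/andP: uq.
Qed.

Lemma linkedE x y : linked x y <-> exists2 p, path (@adj G) x p & last x p = y.
Proof.
split=> [[p [pp lp _]]|[p pp <-]]; first by exists p.
by have [q qP _] := walk_is_path pp; exists q.
Qed.

Lemma linked_sym x y : linked x y -> linked y x.
Proof.
move/linkedE => [p pp <-]; apply/linkedE.
by exists (rev (belast x p)); rewrite ?path_rev ?last_rev_belast.
Qed.

Lemma linked_trans y x z : linked x y -> linked y z -> linked x z.
Proof.
move=> /linkedE[p pp <-] /linkedE[q pq <-]; apply/linkedE.
by exists (p ++ q); rewrite ?cat_path ?pp ?last_cat.
Qed.

Lemma linked_adj x y : adj x y -> linked x y.
Proof. by move=> xy; apply/linkedE; exists [:: y]; rewrite /= ?xy. Qed.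

Lemma shortest_min x y p q : is_shortest_path x y p ->
  path (@adj G) x q -> last x q = y -> size p <= size q.
Proof.
move=> [_ pmin] pq lq; have [q' + sq] := walk_is_path pq.
by rewrite lq => /pmin /leq_trans; apply.
Qed.

Lemma shortest_exists x y : linked x y -> exists p, is_shortest_path x y p.
Proof.
by move=> [p0 p0P]; have [p pP] := nat_argmin size p0P; exists p.
Qed.

Lemma shortest_catl x y p q : is_shortest_path x y (p ++ q) ->
  is_shortest_path x (last x p) p.
Proof.
move=> sh; have [[+ lpq +] _] := sh.
rewrite cat_path -cat_cons cat_uniq => /andP[pp pq] /andP[up _].
split=> [|r [pr lr _]]; first by split.
have : size (p ++ q) <= size (r ++ q).
  apply: shortest_min sh _ _; first by rewrite cat_path pr lr.
  by rewrite last_cat lr -last_cat.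
by rewrite !size_cat leq_add2r.
Qed.

Lemma shortest_suffix d x y p q : is_shortest_path x y (p ++ q) ->
  near d (last x p) y -> size q <= d.
Proof.
move=> sh [r [pr lr sr]]; have [[+ _ _] _] := sh.
rewrite cat_path => /andP[pp _].
have : size (p ++ q) <= size (p ++ r).
  by apply: shortest_min sh _ _; rewrite ?cat_path ?pp ?last_cat.
by rewrite !size_cat leq_add2l => /leq_trans; apply.
Qed.

Lemma shortest_edge x y : adj x y -> is_shortest_path x y [:: y].
Proof.
move=> xy; split.
  split; rewrite /= ?xy // inE andbT.
  by apply: contraTneq xy => ->; rewrite adj_irr.
case=> // -[_ /= xy' _]; by move: xy; rewrite xy' adj_irr.
Qed.

End Walks.

(** * Boundaries of vertex sets *)

Section Boundary.
Variable G : graph.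
Implicit Types (A B P : set G) (x y z : G).

Definition boundary A : set (G * G) :=
  [set e | [/\ adj e.1 e.2, A e.1 & ~ A e.2]].

Definition outer A : set G := [set y | exists2 x, A x & adj x y /\ ~ A y].

(** Connectedness of the subgraph induced by [A], in the form of an
    induction principle for properties that propagate along the edges inside
    [A]. *)
Definition conn A := forall P, (exists2 x, A x & P x) ->
  (forall x y, A x -> A y -> adj x y -> P x -> P y) -> A `<=` P.

(** The boundary of a set with two connected sides is connected up to jumps
    of length [d]. *)
Definition coarse_boundaries d := forall A : set G, conn A -> conn (~` A) ->
  forall Y : set G, (exists2 y, outer A y & Y y) ->
  (forall y z, outer A y -> outer A z -> Y y -> near d y z -> Y z) ->
  outer A `<=` Y.

Lemma conn_setT : connected G -> conn [set: G].
Proof.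
move=> cG P [x _ Px] Pcl y _.
have /linkedE[p pp <-] := cG x y.
elim: p x pp Px => //= z p IH x /andP[xz pp] Px.
by apply: IH => //; exact: Pcl xz Px.
Qed.

Lemma conn_boundary A B x y : conn A -> A x -> B x -> A y -> ~ B y ->
  exists a b, [/\ A a, B a, A b, ~ B b & adj a b].
Proof.
move=> cA Ax Bx Ay nBy; apply: contrapT => no; apply: nBy.
apply: (cA B) Ay; first by exists x.
move=> a b Aa Ab ab Ba; apply: contrapT => nBb.
by apply: no; exists a, b.
Qed.

Lemma near_boundary A d o z : near d o z -> A o -> ~ A z ->
  exists x y, [/\ near d o x, near d o y, adj x y, A x & ~ A y].
Proof.
move=> [p [pp lp sp]] Ao nAz.
suff: exists x y, [/\ x \in o :: p, y \in o :: p, adj x y, A x & ~ A y].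
  move=> [x [y [xp yp xy Ax nAy]]]; exists x, y; split => //.
    by apply: walk_near xp => //; rewrite mem_head.
  by apply: walk_near yp => //; rewrite mem_head.
elim: p o pp lp Ao {sp} => [o _ /= oz|y p IH o /= /andP[oy pp] lp Ao].
  by rewrite oz.
have [Ay|nAy] := pselect (A y).
  have [a [b [ap bp ab Aa nAb]]] := IH y pp lp Ay.
  by exists a, b; split; rewrite // inE ?ap ?bp orbT.
by exists o, y; split; rewrite // !inE ?eqxx ?orbT.
Qed.

End Boundary.

(** * Coarse connectedness of boundaries in hyperbolic graphs *)

Section Parity.
Variables (G : graph) (c : G -> G -> bool).

Fixpoint parity (x : G) (p : seq G) : bool :=
  if p is y :: q then c x y (+) parity y q else false.

Lemma parity_cat x p q :
  parity x (p ++ q) = parity x p (+) parity (last x p) q.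
Proof. by elim: p x => //= y p IH x; rewrite IH addbA. Qed.

Hypothesis c_sym : symmetric c.

Lemma parity_rev x p : parity (last x p) (rev (belast x p)) = parity x p.
Proof.
elim: p x => //= y p IH x.
rewrite rev_cons -cats1 parity_cat IH last_rev_belast.
by rewrite /= addbF addbC c_sym.
Qed.

Variable delta : nat.
Hypothesis hyp : delta_hyperbolic delta G.

Hypothesis short_even : forall x p, path (@adj G) x p -> last x p = x ->
  size p <= 8 * delta.+1 -> parity x p = false.

(** A geodesic triangle with one short side is peeled off from that side:
    the vertex at distance [2 * delta.+1] from the short side on the side
    [g] is within [delta] of the side [g'], which cuts off a quadrilateral
    of length at most [8 * delta.+1] and leaves a smaller triangle of the
    same kind. *)
Lemma parity_triangle o x y g g' e : is_shortest_path o x g ->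
  is_shortest_path o y g' -> is_shortest_path x y e -> size e <= delta.+1 ->
  parity o g (+) parity x e (+) parity o g' = false.
Proof.
have [n] := ubnP (size g).
elim: n x y g g' e => // n IH x y g g' e gn sg sg' se le.
have [[pg lg _] _] := sg; have [[pg' lg' _] _] := sg'.
have [[pe lye _] _] := se.
case: (leqP (2 * delta.+1) (size g)) => [big|small]; last first.
  have lg'' : size g' <= size g + delta.+1.
    apply: (leq_trans (n := size (g ++ e))); last by rewrite size_cat leq_add2l.
    by apply: shortest_min sg' _ _; rewrite ?cat_path ?pg ?lg ?last_cat ?lg.
  have := short_even (x := o) (p := g ++ e ++ rev (belast o g')).
  rewrite !parity_cat lg lye -lg' parity_rev addbA; apply.
  - by rewrite !cat_path lg pg pe lye -lg' path_rev.
  - by rewrite !last_cat lg lye -lg' last_rev_belast.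
  - rewrite !size_cat size_rev size_belast; move: le small lg''.
    by move: (size e) (size g) (size g') => a b m; clear; lia.
pose k := size g - 2 * delta.+1.
pose q1 := take k g; pose q2 := drop k g.
have gE : g = q1 ++ q2 by rewrite cat_take_drop.
have sq1 : size q1 = k by rewrite size_takel // leq_subr.
have sq2 : size q2 = 2 * delta.+1 by rewrite size_drop subKn.
set x1 := last o q1.
have [pq1 pq2] : path (@adj G) o q1 /\ path (@adj G) x1 q2.
  by move: pg; rewrite gE cat_path => /andP.
have lq2 : last x1 q2 = x by rewrite -lg gE last_cat.
have x1g : x1 \in o :: g.
  rewrite gE -cat_cons mem_cat; apply/orP; left; exact: mem_last.
have [v vin [d sd ld]] := hyp.2 _ _ _ _ _ _ sg se sg' _ x1g.
have [[pd lvd _] _] := sd.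
(* The thin triangle condition could also give a vertex of the short side
   [e], but [x1] is at distance [2 * delta.+1] from [x]. *)
have vg' : v \in o :: g'.
  case/orP: vin => // ve; exfalso.
  have nxv : near delta.+1 x v by apply: walk_near ve => //; rewrite mem_head.
  have nx1v : near delta x1 v by exists d.
  have : size q2 <= delta + delta.+1.
    apply: (@shortest_suffix _ _ o x q1); first by rewrite -gE.
    exact: near_trans nx1v (near_sym nxv).
  by rewrite sq2; clear; lia.
case/splitPl: vg' => r1 r2 lr1 in sg' pg' lg' *.
have sr2 : size r2 <= delta + 2 * delta.+1 + delta.+1.
  apply: shortest_suffix sg' _; rewrite lr1.
  apply: (near_trans (y := x)); last by exists e.
  apply: (near_trans (y := x1)); first by apply: near_sym; exists d.
  by exists q2; rewrite sq2.
move: (pg'); rewrite cat_path lr1 => /andP[pr1 pr2].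
have lr2 : last v r2 = y by rewrite -lg' last_cat lr1.
have h1 : parity o q1 (+) parity x1 d (+) parity o r1 = false.
  apply: (IH x1 v); last by exact: leqW.
  - rewrite sq1 /k; move: gn big; move: (size g) => m; clear; lia.
  - by apply: (@shortest_catl _ _ x _ q2); rewrite -gE.
  - by have := shortest_catl sg'; rewrite lr1.
  - exact: sd.
have h2 : parity x1 q2 (+) parity x e (+) parity v r2 (+) parity x1 d = false.
  have pr2' : parity y (rev (belast v r2)) = parity v r2.
    by rewrite -lr2 parity_rev.
  have pd' : parity v (rev (belast x1 d)) = parity x1 d.
    by rewrite -{1}lvd parity_rev.
  have lr2' : last y (rev (belast v r2)) = v by rewrite -lr2 last_rev_belast.
  have := short_even (x := x1)
    (p := q2 ++ e ++ rev (belast v r2) ++ rev (belast x1 d)).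
  rewrite !parity_cat lq2 lye lr2' pr2' pd' !addbA; apply.
  - rewrite !cat_path lq2 lye pq2 pe -lr2 path_rev // last_rev_belast.
    by rewrite -lvd path_rev.
  - by rewrite !last_cat lq2 lye -lr2 last_rev_belast -lvd last_rev_belast.
  - rewrite !size_cat !size_rev !size_belast sq2; move: le ld sr2.
    by move: (size e) (size d) (size r2) => a b m; clear; lia.
rewrite gE !parity_cat lr1 -/x1.
move: h1 h2; case: (parity o q1); case: (parity x1 q2); case: (parity x e);
by case: (parity o r1); case: (parity v r2); case: (parity x1 d).
Qed.

End Parity.

(** Let [c] mark the boundary edges of [A] whose outer end lies in [Y].  A
    closed walk of length at most [d] that uses a marked edge has all its
    boundary edges marked, hence uses an even number of them.  So the parity
    [f] of the number of marked edges on a geodesic from a fixed vertex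
    changes exactly along the marked edges.  It is then constant on both
    sides of [A], and since it changes along one boundary edge, it changes
    along all of them. *)
Lemma outer_coarsely_connected (G : graph) : hyperbolic G ->
  exists d, coarse_boundaries G d.
Proof.
move=> [delta hyp]; exists (8 * delta.+1) => A cA cA' Y.
move=> [y0 [x0 Ax0 [xy0 nAy0]] Yy0] Ycl.
pose cp x y := [/\ A x, ~ A y & Y y].
pose c x y := `[< cp x y >] || `[< cp y x >].
have c_sym : symmetric c by move=> x y; rewrite /c orbC.
have cE x y : c x y = false \/ c x y = `[< A x >] (+) `[< A y >].
  rewrite /c; case: asboolP => [[Ax nAy _]|_] /=.
    by right; rewrite (asboolT Ax) (asboolF nAy).
  case: asboolP => [[Ay nAx _]|_]; last by left.
  by right; rewrite (asboolT Ay) (asboolF nAx).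
have even x p : path (@adj G) x p -> last x p = x ->
    size p <= 8 * delta.+1 -> parity c x p = false.
  move=> pp lp sp.
  have [hit|nohit] := pselect (exists2 y, y \in x :: p & outer A y /\ Y y);
    last first.
    elim: p x pp {lp sp} nohit => //= y p IH x /andP[xy pp] nohit.
    rewrite IH //; last first.
      by move=> [z zp zA]; apply: nohit; exists z; rewrite // inE zp orbT.
    rewrite addbF /c; apply/norP.
    split; apply/asboolP => -[Ha Hb Hc]; apply: nohit.
      exists y; first by rewrite !inE eqxx orbT.
      by split => //; exists x.
    exists x; first by rewrite !inE eqxx.
    by split => //; exists y; rewrite // adj_sym.
  have [y0' y0p [oy Yy]] := hit.
  have all_in z : z \in x :: p -> outer A z -> Y z.
    by move=> zp oz; apply: Ycl oy oz Yy _; apply: walk_near pp sp y0p zp.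
  suff -> : parity c x p = `[< A x >] (+) `[< A (last x p) >].
    by rewrite lp addbb.
  elim: p x pp all_in {lp sp hit y0p} => [|y p IH] x /=; first by rewrite addbb.
  move=> /andP[xy pp] all_in; rewrite IH //; last first.
    by move=> z zp; apply: all_in; rewrite inE zp orbT.
  suff -> : c x y = `[< A x >] (+) `[< A y >].
    by rewrite -addbA (addbA `[< A y >]) addbb addFb.
  have [] := cE x y => // c0; rewrite c0; apply/esym.
  have [Ax|nAx] := asboolP (A x); have [Ay|nAy] := asboolP (A y) => //; exfalso.
    move: c0; rewrite /c asboolT //; split => //; apply: all_in.
      by rewrite !inE eqxx orbT.
    by exists x.
  move: c0; rewrite /c orbC asboolT //; split => //; apply: all_in.
    by rewrite !inE eqxx.
  by exists y; rewrite // adj_sym.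
have tri := parity_triangle c_sym hyp even.
have [g gP] : {g : G -> seq G & forall z, is_shortest_path x0 z (g z)}.
  by apply: choice => z; apply: shortest_exists; exact: hyp.1.
pose f z := parity c x0 (g z).
have fE x y : adj x y -> f x (+) f y = c x y.
  move=> xy; have := tri _ _ _ _ _ _ (gP x) (gP y) (shortest_edge xy) isT.
  rewrite /= addbF -/(f x) -/(f y).
  by case: (f x); case: (f y); case: (c x y).
have fA z : A z -> f z = f x0.
  apply: (cA [set z | f z = f x0]); first by exists x0.
  move=> a b Aa Ab ab /= <-; apply/esym/eqP; rewrite -negb_add fE //.
  by have [] := cE a b => ->; rewrite // !asboolT.
have fA' z : ~ A z -> f z = f y0.
  apply: (cA' [set z | f z = f y0]); first by exists y0.
  move=> a b Aa Ab ab /= <-; apply/esym/eqP; rewrite -negb_add fE //.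
  by have [] := cE a b => ->; rewrite // !asboolF.
move=> y [x Ax [xy nAy]]; apply: contrapT => nYy.
have : c x y = c x0 y0 by rewrite -!fE // (fA x) // (fA' y).
have -> : c x0 y0 = true by rewrite /c asboolT.
by rewrite /c => /orP[] /asboolP[].
Qed.

(** * Cardinals of finite sets *)

(** The value is zero on infinite sets, whence the finiteness hypotheses
    below. *)
Definition ncard (T : choiceType) (A : set T) : nat := #|` fset_set A|.

Section Ncard.
Variables T U : choiceType.
Implicit Types (A B X Y : set T) (f : T -> U).

Lemma ncard_le A B : finite_set B -> A `<=` B -> ncard A <= ncard B.
Proof.
move=> fB AB; have fA := sub_finite_set AB fB.
by apply: fsubset_leq_card; rewrite -fset_set_sub.
Qed.

Lemma ncard_sub_eq A B : finite_set B -> A `<=` B -> ncard B <= ncard A ->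
  A = B.
Proof.
move=> fB AB BA; have fA := sub_finite_set AB fB.
apply: fset_set_inj => //; apply/eqP.
by rewrite eqEfcard BA andbT -fset_set_sub.
Qed.

Lemma ncard_image_le f A : finite_set A -> ncard (f @` A) <= ncard A.
Proof. by move=> fA; rewrite /ncard fset_set_image // leq_imfset_card. Qed.

Lemma ncard_image f A : finite_set A -> {in A &, injective f} ->
  ncard (f @` A) = ncard A.
Proof.
move=> fA fI; apply/fcard_eq => //; first exact: finite_image.
exact: inj_card_eq.
Qed.

Lemma size_ncard (s : seq T) A : finite_set A -> uniq s ->
  (forall x, x \in s -> A x) -> size s <= ncard A.
Proof.
move=> fA us sA; rewrite -(undup_id us) -(card_fseq s).
apply: fsubset_leq_card; apply/fsubsetP => x.
by rewrite !inE in_fset_set // inE => /sA.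
Qed.

(** Submodularity in the form used for boundaries and for sets of crossing
    bonds: what is replaced has a larger union and a larger intersection. *)
Lemma ncard_exchange X Y A B : finite_set A -> finite_set B ->
  X `|` Y `<=` A `|` B -> X `&` Y `<=` A `&` B ->
  ncard X + ncard Y <= ncard A + ncard B.
Proof.
move=> fA fB UU II; have fU : finite_set (A `|` B) by rewrite finite_setU.
have fX : finite_set X.
  by apply: sub_finite_set fU => z Xz; apply: UU; left.
have fY : finite_set Y.
  by apply: sub_finite_set fU => z Yz; apply: UU; right.
rewrite /ncard -cardfsUI -[leqRHS]cardfsUI -!fset_setU // -!fset_setI //.
by apply: leq_add; apply: ncard_le => //; exact: finite_setIl.
Qed.

Lemma ncard_exchange_lt z X Y A B : finite_set A -> finite_set B ->
  X `|` Y `<=` A `|` B -> X `&` Y `<=` A `&` B ->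
  (A `|` B) z -> ~ X z -> ~ Y z ->
  ncard X + ncard Y < ncard A + ncard B.
Proof.
move=> fA fB UU II ABz nXz nYz.
have fU : finite_set (A `|` B) by rewrite finite_setU.
have fX : finite_set X.
  by apply: sub_finite_set fU => t Xt; apply: UU; left.
have fY : finite_set Y.
  by apply: sub_finite_set fU => t Yt; apply: UU; right.
rewrite /ncard -cardfsUI -[ltnRHS]cardfsUI -!fset_setU // -!fset_setI //.
rewrite -addSn leq_add //; last by apply: ncard_le => //; exact: finite_setIl.
rewrite ltnNge; apply/negP => /(ncard_sub_eq fU UU) E.
by move: ABz; rewrite -E => -[].
Qed.

End Ncard.

Lemma finite_powerset (T : choiceType) (Q : set T) :
  finite_set Q -> finite_set [set B | B `<=` Q].
Proof.
move=> fQ; apply: (@sub_finite_set _ _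
  ((fun X : {fset T} => [set` X]) @` [set` fpowerset (fset_set Q)])).
  move=> B BQ /=; have fB := sub_finite_set BQ fQ.
  by exists (fset_set B); rewrite ?fset_setK //= fpowersetE -fset_set_sub.
exact/finite_image/finite_fset.
Qed.

Lemma minimal_set (T : choiceType) (X : set (set T)) A0 : finite_set X ->
  X A0 -> exists A, X A /\ forall B, X B -> B `<=` A -> B = A.
Proof.
move=> fX XA0.
pose below A := [set B | X B /\ B `<=` A].
have fb A : finite_set (below A) by apply: sub_finite_set fX => B [].
have [A [XA minA]] := nat_argmin (fun A => ncard (below A)) XA0.
exists A; split => // B XB BA.
have sub : below B `<=` below A.
  by move=> C [XC CB]; split => //; exact: subset_trans BA.
have E : below B = below A.
  by apply: ncard_sub_eq => //; exact: minA.
have [_ AB] : below B A by rewrite E; split.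
by apply/seteqP.
Qed.

(** * Finiteness of the set of small bonds near a vertex *)

Section Bonds.
Variable G : graph.
Implicit Types (A B C : set G) (x y z : G).

Definition bond n A := [/\ conn A, conn (~` A),
  finite_set (boundary A) & ncard (boundary A) <= n].

Lemma finite_ball d x : locally_finite G -> finite_set [set y | near d x y].
Proof.
move=> lf; elim: d x => [|d IH] x.
  apply: (@sub_finite_set _ _ [set x]); last exact: finite_set1.
  by move=> y [[|z p] [_ /= ly sp]] //; rewrite -ly.
apply: (@sub_finite_set _ _ ([set x] `|`
    \bigcup_(z in [set z | adj x z]) [set y | near d z y])).
  move=> y [[|z p] [/= + ly sp]]; first by left.
  by move=> /andP[xz pz]; right; exists z => //; exists p.
by rewrite finite_setU; split; [exact: finite_set1 | apply: bigcup_finite].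
Qed.

Lemma outerE A : outer A = snd @` boundary A.
Proof.
apply/seteqP; split => [y [x Ax [xy nAy]]|_ [[x y] [/= xy Ax nAy] <-]].
  by exists (x, y).
by exists x.
Qed.

Lemma boundaryC A : boundary (~` A) = (fun e => (e.2, e.1)) @` boundary A.
Proof.
apply/seteqP; split.
  move=> [x y] [/= xy nAx /contrapT Ay].
  by exists (y, x) => //; split; rewrite //= adj_sym.
move=> _ [[x y] [/= xy Ax nAy] <-].
by split; rewrite /= 1?adj_sym //; apply.
Qed.

Lemma finite_boundaryC A :
  finite_set (boundary A) -> finite_set (boundary (~` A)).
Proof. by rewrite boundaryC; exact: finite_image. Qed.

Lemma ncard_boundaryC A : finite_set (boundary A) ->
  ncard (boundary (~` A)) = ncard (boundary A).
Proof.
move=> fA; rewrite boundaryC ncard_image // => -[a b] [c d] _ _.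
by case=> -> ->.
Qed.

Lemma bondC n A : bond n A -> bond n (~` A).
Proof.
move=> [cA cA' fA nA]; split; rewrite ?setCK //; first exact: finite_boundaryC.
by rewrite ncard_boundaryC.
Qed.

(** Unless the part of the outer boundary within [j * d] of [y] is all of
    it, it has more than [j] elements. *)
Lemma outer_in_ball n d A y : coarse_boundaries G d -> bond n A -> outer A y ->
  outer A `<=` [set z | near (n * d) y z].
Proof.
move=> cb [cA cA' fA nA] oy.
have fo : finite_set (outer A) by rewrite outerE; exact: finite_image.
have claim j : outer A `<=` [set z | near (j * d) y z] \/
    exists s, [/\ uniq s, size s = j.+1 &
      forall z, z \in s -> outer A z /\ near (j * d) y z].
  elim: j => [|j [IH|[s [us ss sP]]]].
  - right; exists [:: y]; split => // z; rewrite inE => /eqP->.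
    by split => //; exact: near0.
  - by left => z /IH; apply: near_le; rewrite mulSn leq_addl.
  have [[a [b [ain ob ab bs]]]|stuck] := pselect (exists a b,
      [/\ a \in s, outer A b, near d a b & b \notin s]).
    right; exists (b :: s); split; rewrite /= ?us ?bs ?ss // => z.
    rewrite inE => /predU1P[->|/sP[oz nz]]; split => //.
      by rewrite mulSn addnC; apply: near_trans ab; exact: (sP a ain).2.
    by apply: near_le nz; rewrite mulSn leq_addl.
  left => z oz; have : z \in s.
    move: z oz; apply: (cb A cA cA' (fun z => z \in s)).
      case: s {us stuck} ss sP => // a s _ sP.
      by exists a; rewrite ?mem_head //; apply: (sP a _).1; rewrite mem_head.
    move=> a b oa ob ain ab; apply: contrapT => /negP bs.
    by apply: stuck; exists a, b.
  by move=> /sP[_]; apply: near_le; rewrite mulSn leq_addl.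
have [//|[s [us ss sP]]] := claim n.
have : n < ncard (outer A).
  by rewrite -ss; apply: size_ncard => // z /sP[].
rewrite outerE ltnNge => /negP[]; exact: leq_trans (ncard_image_le _ fA) nA.
Qed.

(** Since a bond has connected sides, it is determined by its trace on any
    set that contains its outer boundary; by coarse connectedness this
    boundary lies in a ball of bounded radius. *)
Lemma finite_bonds_near d n R o : locally_finite G -> coarse_boundaries G d ->
  finite_set [set C | bond n C /\ exists x y,
    [/\ near R o x, near R o y, adj x y, C x & ~ C y]].
Proof.
move=> lf cb; set F := [set C | _].
pose Q := [set z | near (R + n * d) o z].
have fQ : finite_set Q by exact: finite_ball.
have outQ C : F C -> outer C `<=` Q.
  move=> [bC [x [y [_ ny xy Cx nCy]]]] z oz.
  apply: (near_trans ny); apply: (outer_in_ball cb bC) oz.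
  by exists x.
have sub C D : F C -> F D -> C `&` Q = D `&` Q -> C `<=` D.
  move=> FC FD E; have [[cC _ _ _] [x [y [nx _ _ Cx _]]]] := FC.
  apply: cC; first exists x => //.
    suff : (D `&` Q) x by case.
    by rewrite -E; split => //; apply: near_le nx; exact: leq_addr.
  move=> a b Ca Cb ab Da; apply: contrapT => nDb; apply: (nDb).
  suff : (D `&` Q) b by case.
  by rewrite -E; split => //; apply: (outQ D FD); exists a.
have I : {in F &, injective (fun C => C `&` Q)}.
  move=> C D; rewrite !inE => FC FD E.
  by apply/seteqP; split; apply: sub.
rewrite -(eq_finite_set (inj_card_eq I)).
apply: sub_finite_set (finite_powerset fQ) => _ [C _ <-].
by move=> z [].
Qed.

End Bonds.

(** * Minimum cuts between rays *)

Lemma finite_nat_bounded (X : set nat) : finite_set X ->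
  exists N, forall n, X n -> n < N.
Proof.
move=> fX; exists (\max_(i <- fset_set X) i).+1 => n Xn.
rewrite ltnS; apply: (@leq_bigmax_seq _ _ xpredT id) => //.
by rewrite in_fset_set // inE.
Qed.

Section Eventually.
Variable G : graph.
Implicit Types (A B C D : set G) (r s : nat -> G).

Lemma ev_sub r A B : A `<=` B -> eventually_in r A -> eventually_in r B.
Proof. by move=> AB [N rA]; exists N => n /rA /AB. Qed.

Lemma evI r A B : eventually_in r A -> eventually_in r B ->
  eventually_in r (A `&` B).
Proof.
move=> [M rA] [N rB]; exists (maxn M N) => n.
by rewrite geq_max => /andP[/rA ? /rB].
Qed.

Lemma ev_point r A : eventually_in r A -> exists x, A x.
Proof. by move=> [N rA]; exists (r N); exact: rA. Qed.

(** A ray is injective, so it uses a finite set of edges only finitely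
    often. *)
Lemma ray_side r A : rays G r -> finite_set (boundary A) ->
  eventually_in r A \/ eventually_in r (~` A).
Proof.
move=> [rI radj] fA.
have bounded B : finite_set (boundary B) ->
    exists N, forall n, N <= n -> B (r n) -> B (r n.+1).
  move=> fB; have fX : finite_set [set n | boundary B (r n, r n.+1)].
    by apply: finite_preimage fB => m n _ _ [] /rI.
  have [N NP] := finite_nat_bounded fX.
  exists N => n Nn Bn; apply: contrapT => nBn.
  by have := NP n (And3 (radj n) Bn nBn); rewrite ltnNge Nn.
have [M MP] := bounded A fA.
have [[m [Mm Am]]|no] := pselect (exists m, M <= m /\ A (r m)).
  left; exists m => n; elim: n => [|n IH]; first by rewrite leqn0 => /eqP <-.
  rewrite leq_eqVlt => /predU1P[<- //|mn].
  by apply: MP; [exact: leq_trans Mm mn | exact: IH].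
by right; exists M => n Mn An; apply: no; exists n.
Qed.

Definition separating r s A :=
  [/\ finite_set (boundary A), eventually_in r A & eventually_in s (~` A)].

Definition mincut r s A := separating r s A /\
  forall B, separating r s B -> ncard (boundary A) <= ncard (boundary B).

Lemma separatingC r s A : separating r s A -> separating s r (~` A).
Proof.
by move=> [fA rA sA]; split; rewrite ?setCK //; exact: finite_boundaryC.
Qed.

Lemma mincutC r s A : mincut r s A -> mincut s r (~` A).
Proof.
move=> [sA minA]; split; first exact: separatingC.
move=> B sB; have [fA _ _] := sA; have [fB _ _] := sB.
by rewrite ncard_boundaryC // -(ncard_boundaryC fB); apply/minA/separatingC.
Qed.

Lemma mincut_exists r s A0 : separating r s A0 -> exists A, mincut r s A.
Proof.
exact: (nat_argmin (fun A => ncard (boundary A))).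
Qed.

Hypothesis Gconn : connected G.

Lemma boundary_nonempty A x y : A x -> ~ A y -> exists e, boundary A e.
Proof.
move=> Ax nAy.
have [a [b [_ Aa _ nAb ab]]] := conn_boundary (conn_setT Gconn) I Ax I nAy.
by exists (a, b).
Qed.

(** If a union of components of the side [A] contains the tail of [r], then
    by minimality it has the whole boundary of [A], so that the remaining
    part of [A] would be a union of components of the graph. *)
Lemma mincut_conn r s A : rays G r -> mincut r s A -> conn A.
Proof.
move=> [_ radj] [[fA rA sA] minA] P [x0 Ax0 Px0] Pcl.
have [N rN] := rA.
have main Q : (forall x y, A x -> A y -> adj x y -> Q x -> Q y) ->
    Q (r N) -> A `<=` Q.
  move=> Qcl QN.
  have QN' n : N <= n -> Q (r n).
    elim: n => [|n IH]; first by rewrite leqn0 => /eqP <-.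
    rewrite leq_eqVlt => /predU1P[<- //|mn].
    have An : A (r n) by exact: rN.
    have An1 : A (r n.+1) by apply: rN; exact: ltnW.
    exact: Qcl An An1 (radj n) (IH mn).
  have bsub : boundary (A `&` Q) `<=` boundary A.
    move=> [x y] [/= xy [Ax Qx] nAQ]; split => //= Ay; apply: nAQ; split => //.
    exact: Qcl xy Qx.
  have bE : boundary (A `&` Q) = boundary A.
    apply: ncard_sub_eq => //; apply: minA; split.
    - exact: sub_finite_set fA.
    - by exists N => n Nn; split; [exact: rN | exact: QN'].
    - by apply: ev_sub sA => z nAz [].
  move=> z Az; apply: contrapT => nQz.
  have AQz : (A `\` Q) z by split.
  have nAQN : ~ (A `\` Q) (r N) by case.
  have [[a b] [/= ab [Aa nQa] nAQb]] := boundary_nonempty AQz nAQN.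
  have [Ab|nAb] := pselect (A b).
    apply: nAQb; split => // Qb; apply: nQa; apply: Qcl Qb => //.
    by rewrite adj_sym.
  have : boundary A (a, b) by split.
  by rewrite -bE => -[/= _ []].
have [PN|nPN] := pselect (P (r N)); first exact: main.
move=> z Az; exfalso.
apply: (main (~` P) _ nPN x0 Ax0) => // x y Ax Ay xy nPx Py; apply: nPx.
by apply: Pcl Py => //; rewrite adj_sym.
Qed.

Lemma mincut_bond n r s A : rays G r -> rays G s -> mincut r s A ->
  ncard (boundary A) <= n -> bond n A.
Proof.
move=> rr rs mA nA; split => //.
- exact: mincut_conn mA.
- exact: mincut_conn (mincutC mA).
- by case: mA => -[].
Qed.

Definition cross A B := [/\ (A `&` B) !=set0, (A `&` ~` B) !=set0,
  (~` A `&` B) !=set0 & (~` A `&` ~` B) !=set0].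

Lemma cross_sym A B : cross A B -> cross B A.
Proof. by case=> h1 h2 h3 h4; split; rewrite setIC. Qed.

Lemma crossC A B : cross (~` A) B = cross A B.
Proof. by apply/propext; split => -[]; rewrite /cross ?setCK; split. Qed.

Definition crossing n A := [set D | bond n D /\ cross A D].

Lemma crossing_setC n A : crossing n (~` A) = crossing n A.
Proof. by rewrite /crossing; under eq_fun do rewrite crossC. Qed.

Definition optimal n r s A := [/\ mincut r s A, ncard (boundary A) <= n &
  forall B, mincut r s B -> ncard (crossing n A) <= ncard (crossing n B)].

Lemma optimalC n r s A : optimal n r s A -> optimal n s r (~` A).
Proof.
move=> [mA nA cA]; split; first exact: mincutC.
  by rewrite ncard_boundaryC //; case: mA => -[].
by move=> B /mincutC /cA; rewrite !crossing_setC.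
Qed.

Lemma optimal_exists n r s A0 : mincut r s A0 -> ncard (boundary A0) <= n ->
  exists A, optimal n r s A.
Proof.
move=> mA0 nA0.
have [A [mA minA]] := nat_argmin (fun A => ncard (crossing n A)) mA0.
exists A; split => //; apply: leq_trans nA0; apply: mA.2; exact: mA0.1.
Qed.

Section Uncrossing.
Variable d : nat.
Hypotheses (lf : locally_finite G) (cb : coarse_boundaries G d).

Lemma near_all (x y : G) : exists k, near k x y.
Proof.
have /linkedE[p pp lp] := Gconn x y.
by exists (size p); exists p.
Qed.

(** A bond without an edge in a ball around the boundary of [A] has this
    ball on one side, and its other side, being connected, does not meet
    both sides of [A]. *)
Lemma finite_crossing n A :
  finite_set (boundary A) -> finite_set (crossing n A).
Proof.
move=> fA.
have [[o _]|nov] := pselect (exists o : G, True); last first.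
  apply: (@sub_finite_set _ _ set0); last exact: finite_set0.
  by move=> D [_ [[x _] _ _ _]]; apply: nov; exists x.
have [R RP] : exists R, forall e, boundary A e -> near R o e.1 /\ near R o e.2.
  have [k kP] := choice (near_all o).
  have fk : finite_set ((fun e => maxn (k e.1) (k e.2)) @` boundary A).
    exact: finite_image.
  have [R RP] := finite_nat_bounded fk.
  exists R => e Ae; have : maxn (k e.1) (k e.2) < R by apply: RP; exists e.
  rewrite gtn_max => /andP[h1 h2].
  by split; [exact: near_le (ltnW h1) (kP _) | exact: near_le (ltnW h2) (kP _)].
pose F := [set C | bond n C /\ exists x y,
    [/\ near R o x, near R o y, adj x y, C x & ~ C y]].
have fF : finite_set F by exact: finite_bonds_near lf cb.
have half D : bond n D -> cross A D -> D o -> F D.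
  move=> bD [_ [x [Ax nDx]] _ [y [nAy nDy]]] Do; split => //.
  have [_ cD' _ _] := bD.
  have [a [b [nDa Aa nDb nAb ab]]] := conn_boundary cD' nDx Ax nDy nAy.
  have [na _] := RP (a, b) (And3 ab Aa nAb).
  have [u [v [nu nv uv Du nDv]]] := near_boundary na Do nDa.
  by exists u, v.
apply: (@sub_finite_set _ _ (F `|` (@setC G) @` F)); last first.
  by rewrite finite_setU; split => //; exact: finite_image.
move=> D [bD cD]; have [Do|nDo] := pselect (D o); first by left; exact: half.
right; exists (~` D); last by rewrite setCK.
apply: half => //; first exact: bondC.
by apply: cross_sym; rewrite crossC; exact: cross_sym.
Qed.

Lemma boundary_exchange A B :
  boundary (A `&` B) `|` boundary (A `|` B) `<=` boundary A `|` boundary B /\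
  boundary (A `&` B) `&` boundary (A `|` B) `<=` boundary A `&` boundary B.
Proof.
split=> -[x y].
  case=> -[/= xy].
    move=> [Ax Bx] nAB; have [Ay|nAy] := pselect (A y); last by left.
    by right; split => //= By; apply: nAB.
  move=> [Ax|Bx] nAB.
    by left; split => //= Ay; apply: nAB; left.
  by right; split => //= By; apply: nAB; right.
move=> [[/= xy [Ax Bx] _] [/= _ _ nAB]].
split; split => //= h; apply: nAB; [by left | by right].
Qed.

(** When a bond crosses [A `&` B] or [A `|` B], the only intersection that
    it may lack for crossing [A] or [B] is supplied by the vertex that
    [cross A B] provides in the opposite corner. *)
Lemma crossing_exchange n A B : cross A B ->
  crossing n (A `&` B) `|` crossing n (A `|` B) `<=`
    crossing n A `|` crossing n B /\
  crossing n (A `&` B) `&` crossing n (A `|` B) `<=`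
    crossing n A `&` crossing n B.
Proof.
move=> [[p [Ap Bp]] _ _ [q [nAq nBq]]]; split => D.
  case=> -[bD].
  - move=> [[x [[Ax Bx] Dx]] [y [[Ay By] nDy]] [z [nABz Dz]] [t [nABt nDt]]].
    have [Dq|nDq] := pselect (D q).
    + have [At|nAt] := pselect (A t).
        right; split => //; split; [by exists x|by exists y|by exists q|].
        by exists t; split => // Bt; apply: nABt.
      by left; split => //; split; [exists x|exists y|exists q|exists t].
    + have [Az|nAz] := pselect (A z).
        right; split => //; split; [by exists x|by exists y| |by exists q].
        by exists z; split => // Bz; apply: nABz.
      by left; split => //; split; [exists x|exists y|exists z|exists q].
  - move=> [[x [ABx Dx]] [y [ABy nDy]] [z [nABz Dz]] [t [nABt nDt]]].
    have [nAz nBz] : ~ A z /\ ~ B z by split => h; apply: nABz; [left|right].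
    have [nAt nBt] : ~ A t /\ ~ B t by split => h; apply: nABt; [left|right].
    have [Dp|nDp] := pselect (D p).
    + case: ABy => [Ay|By].
        by left; split => //; split; [exists p|exists y|exists z|exists t].
      by right; split => //; split; [exists p|exists y|exists z|exists t].
    + case: ABx => [Ax|Bx].
        by left; split => //; split; [exists x|exists p|exists z|exists t].
      by right; split => //; split; [exists x|exists p|exists z|exists t].
move=> [[bD [[x [[Ax Bx] Dx]] [y [[Ay By] nDy]] _ _]]].
move=> [_ [_ _ [z [nABz Dz]] [t [nABt nDt]]]].
have [nAz nBz] : ~ A z /\ ~ B z by split => h; apply: nABz; [left|right].
have [nAt nBt] : ~ A t /\ ~ B t by split => h; apply: nABt; [left|right].
by split; split => //; split; [exists x|exists y|exists z|exists t|
  exists x|exists y|exists z|exists t].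
Qed.

(** Otherwise the corners [A `&` B] and [A `|` B] still separate the
    respective rays, so submodularity makes them minimum cuts.  In total
    they are crossed by fewer bonds than [A] and [B], since [A] and [B] no
    longer count for each other, so that one of the two corners contradicts
    optimality. *)
Lemma optimal_no_corners n r s r' s' A B : rays G r -> rays G s ->
  optimal n r s A -> optimal n r' s' B ->
  eventually_in r B -> eventually_in s' (~` A) -> ~ cross A B.
Proof.
move=> rr rs [mA nA optA] [mB nB optB] rB s'A cAB.
have [[fA rA sA] minA] := mA; have [[fB r'B s'B] minB] := mB.
have [bU bI] := boundary_exchange A B.
have fAB : finite_set (boundary A `|` boundary B) by rewrite finite_setU.
have sepI : separating r s (A `&` B).
  split; last by apply: ev_sub sA => x nAx [].
    by apply: sub_finite_set fAB => e ?; apply: bU; left.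
  exact: evI.
have sepU : separating r' s' (A `|` B).
  split; last by rewrite setCU; exact: evI.
    by apply: sub_finite_set fAB => e ?; apply: bU; right.
  by apply: ev_sub r'B => x; right.
have le := ncard_exchange fA fB bU bI.
have geI := minA _ sepI; have geU := minB _ sepU.
have mI : mincut r s (A `&` B).
  split => // C /minA; apply: leq_trans.
  rewrite -(leq_add2r (ncard (boundary B))); apply: leq_trans le.
  by rewrite leq_add2l.
have mU : mincut r' s' (A `|` B).
  split => // C /minB; apply: leq_trans.
  rewrite -(leq_add2l (ncard (boundary A))); apply: leq_trans le.
  by rewrite leq_add2r.
have [cU cI] := crossing_exchange n cAB.
have : ncard (crossing n (A `&` B)) + ncard (crossing n (A `|` B)) <
    ncard (crossing n A) + ncard (crossing n B).
  apply: (@ncard_exchange_lt _ A) cU cI _ _ _; try exact: finite_crossing.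
  - right; split; first exact: mincut_bond rr rs mA nA.
    exact: cross_sym.
  - by move=> [_ [_ [x [[Ax _] nAx]] _ _]].
  - by move=> [_ [_ _ [x [nABx Ax]] _]]; apply: nABx; left.
have := optA _ mI; have := optB _ mU.
by move=> leU leI; rewrite ltnNge leq_add.
Qed.

(** Up to exchanging [A] and [B] and passing to complements, the previous
    lemma applies unless the rays [r] and [s] lie in one pair of opposite
    corners and [r'] and [s'] in the other one. *)
Lemma optimal_nested n r s r' s' A B :
  rays G r -> rays G s -> rays G r' -> rays G s' ->
  optimal n r s A -> optimal n r' s' B -> ~ cross A B.
Proof.
move=> rr rs rr' rs' oA oB cAB.
have [[[fA rA sA] minA] nA optA] := oA; have [[[fB rB sB] minB] nB optB] := oB.
have oA' := optimalC oA; have oB' := optimalC oB.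
have cBA := cross_sym cAB.
have cAB' : cross A (~` B) by apply: cross_sym; rewrite crossC.
have cBA' := cross_sym cAB'.
have n1 : eventually_in r B -> ~ eventually_in s' (~` A).
  by move=> h1 h2; apply: optimal_no_corners oA oB h1 h2 cAB.
have n2 : eventually_in r' A -> ~ eventually_in s (~` B).
  by move=> h1 h2; apply: optimal_no_corners oB oA h1 h2 cBA.
have n3 : eventually_in r (~` B) -> ~ eventually_in r' (~` A).
  by move=> h1 h2; apply: optimal_no_corners oA oB' h1 h2 cAB'.
have n4 : eventually_in s' A -> ~ eventually_in s B.
  move=> h1 h2; apply: optimal_no_corners oB' oA h1 _ cBA' => //.
  by rewrite setCK.
(* In the exceptional configuration each of [A] and [B0] separates both
   pairs of rays, so both are optimal for both pairs and [B0] can be used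
   with [r, s]. *)
suff special B0 a b : rays G a -> rays G b -> optimal n a b B0 -> cross A B0 ->
    eventually_in r B0 -> eventually_in s (~` B0) ->
    separating a b A \/ separating b a A -> False.
  have [rB'|rB'] := ray_side rr fB.
    have [s'A|/(n1 rB') //] := ray_side rs' fA.
    have [/(n4 s'A) //|sB'] := ray_side rs fB.
    have [r'A|r'A] := ray_side rr' fA; first by case: (n2 r'A).
    by apply: (special B r' s') => //; right.
  have [r'A|/(n3 rB') //] := ray_side rr' fA.
  have [sB'|/(n2 r'A) //] := ray_side rs fB.
  have [s'A|s'A] := ray_side rs' fA; first by case: (n4 s'A).
  by apply: (special (~` B) s' r') => //; rewrite ?setCK //; right.
move=> ra rb oB0 cAB0 rB0 sB0 sepA.
have [[[fB0 aB0 bB0] minB0] nB0 optB0] := oB0.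
have sizes : ncard (boundary B0) <= ncard (boundary A).
  case: sepA => [/minB0 //|/separatingC /minB0].
  by rewrite ncard_boundaryC.
have mB0 : mincut r s B0.
  split; first by split.
  by move=> C /minA; exact: leq_trans.
have crossB : ncard (crossing n B0) <= ncard (crossing n A).
  have key C : mincut a b C -> ncard (crossing n B0) <= ncard (crossing n C).
    exact: optB0.
  have sizes' : ncard (boundary A) <= ncard (boundary B0) by apply: minA; split.
  case: sepA => [sepA|sepA].
    by apply: key; split => // C /minB0; exact: leq_trans.
  rewrite -(crossing_setC n A); apply: key; split; first exact: separatingC.
  by move=> C /minB0; rewrite ncard_boundaryC //; exact: leq_trans.
have oB0' : optimal n r s B0.
  split => // C /optA; exact: leq_trans.
exact: optimal_no_corners oA oB0' rB0 sA cAB0.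
Qed.

End Uncrossing.
End Eventually.

(** * Weights on nested families of cuts *)

Section Weights.
Variables (G : graph) (N : set (set G)) (psi : set G -> bool) (d : nat).
Implicit Types (A B C D : set G) (x y u v w : G).

(** The members of [N], up to complementation, are viewed as the edges of a
    tree whose nodes include the vertices of the graph.  For [w = v] a
    tripod consists of the tree edges on the path from [u] to [v]; in
    general, those on the path from [u] to the median of [u], [v] and [w]. *)
Definition tripod u v w : set (set G) := [set C | [/\ N C, C u, ~ C v & ~ C w]].

Definition tripod_weight u v w : bool :=
  \big[addb/false]_(C \in tripod u v w) psi C.

(** The tree edges on the path from [x] through the edge [A], if [A]
    contains [x]; their total weight is the potential at the far end of [A]. *)
Definition below A x : set (set G) := [set C | [/\ N C, C x & C `<=` A]].

Hypothesis N_conn : forall C, N C -> conn C.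
Hypothesis N_setC : forall C, N C -> N (~` C).
Hypothesis N_nested : forall C D, N C -> N D -> ~ cross C D.
Hypothesis N_finite : forall u v, finite_set (tripod u v v).
Hypothesis psiC : forall C, N C -> psi (~` C) = psi C.
Hypothesis Gconn : connected G.
Hypothesis cb : coarse_boundaries G d.
Hypothesis weight0 : forall u v w, near d.+1 u v -> near d.+1 u w ->
  tripod_weight u v w = false.

Lemma nested_comparable x y C D : N C -> N D -> C x -> D x -> ~ C y -> ~ D y ->
  C `<=` D \/ D `<=` C.
Proof.
move=> NC ND Cx Dx nCy nDy; apply: contrapT => /not_orP[].
move=> /existsNP[z /not_implyP[Cz nDz]] /existsNP[t /not_implyP[Dt nCt]].
by apply: (N_nested NC ND); split; [exists x|exists z|exists t|exists y].
Qed.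

Lemma tripodvv u v C : tripod u v v C <-> [/\ N C, C u & ~ C v].
Proof. by split=> -[]; split. Qed.

Lemma finite_below A x y : ~ A y -> finite_set (below A x).
Proof.
move=> nAy; apply: (sub_finite_set _ (N_finite x y)) => C [NC Cx CA].
by apply/tripodvv; split => // /CA.
Qed.

(** A cut of [N] that separates [x] from [x'] lies in [A] or has its
    complement in [A].  So these cuts are, up to complementation, those in
    which [below A x] and [below A x'] differ, and their total weight
    vanishes. *)
Lemma below_weight_adj A x x' : N A -> (exists y, ~ A y) -> A x -> A x' ->
  adj x x' -> \big[addb/false]_(C \in below A x) psi C =
              \big[addb/false]_(C \in below A x') psi C.
Proof.
move=> NA [y nAy] Ax Ax' xx'.
pose P := below A x `&` below A x'.
pose D1 := [set C | below A x C /\ ~ C x'].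
pose D2 := [set C | below A x' C /\ ~ C x].
have fx := finite_below x nAy; have fx' := finite_below x' nAy.
have fP : finite_set P by exact: finite_setIl.
have f1 : finite_set D1 by apply: sub_finite_set fx => C [].
have f2 : finite_set D2 by apply: sub_finite_set fx' => C [].
have E1 : below A x = P `|` D1.
  apply/seteqP; split => C; last by case=> -[].
  move=> [NC Cx CA]; have [Cx'|nCx'] := pselect (C x'); last by right.
  by left.
have E2 : below A x' = P `|` D2.
  apply/seteqP; split => C; last by case=> -[].
  move=> [NC Cx CA]; have [Cx'|nCx'] := pselect (C x); last by right.
  by left.
have E3 : tripod x x' x' = D1 `|` (@setC G) @` D2.
  apply/seteqP; split => C; last first.
    case=> [[[NC Cx CA] nCx']|[D [[ND Dx' DA] nDx] <-]].
      exact/tripodvv.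
    by apply/tripodvv; split; [exact: N_setC| |apply].
  move/tripodvv => [NC Cx nCx'].
  have [CA|nCA] := pselect (C `<=` A); first by left.
  right; exists (~` C); last by rewrite setCK.
  split; last by apply.
  split => //; first exact: N_setC.
  move: nCA => /existsNP[z /not_implyP[Cz nAz]].
  move=> t nCt; apply: contrapT => nAt.
  by apply: (N_nested NA NC); split; [exists x|exists x'|exists z|exists t].
have nxx' : near d.+1 x x' by exact: near_le (near1 xx').
have s0 := weight0 nxx' nxx'.
move: s0; rewrite /tripod_weight E3 fsbigU0 //; last 2 first.
- exact: finite_image.
- move=> C [[[NC Cx CA] _] [D [[ND Dx DA] _] DC]].
  have [Cy|nCy] := pselect (C y); first exact: nAy (CA _ Cy).
  by apply/nAy/DA; apply: contrapT => nDy; apply: nCy; rewrite -DC.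
have inj2 : set_inj D2 (@setC G) by move=> C D _ _; exact: setC_inj.
rewrite (fsbig_image _ _ _ inj2).
rewrite (eq_fsbigr psi); last first.
  by move=> C; rewrite inE => -[[NC _ _] _]; rewrite /= psiC.
move=> s0; rewrite E1 E2 !fsbigU0 //.
- have xor_eq (a b : bool) : a (+) b = false -> a = b by case: a; case: b.
  by congr (_ (+) _); exact: xor_eq s0.
- by move=> C [[[_ Cx _] _] [_ nCx]].
- by move=> C [[_ [_ Cx' _]] [_ nCx']].
Qed.

Lemma below_weight_const A x x' : N A -> (exists y, ~ A y) -> A x -> A x' ->
  \big[addb/false]_(C \in below A x) psi C =
  \big[addb/false]_(C \in below A x') psi C.
Proof.
move=> NA exy Ax; move: x'.
apply: (N_conn NA (P := fun x' => \big[addb/false]_(C \in below A x) psi C =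
  \big[addb/false]_(C \in below A x') psi C)); first by exists x.
by move=> a b Aa Ab ab ->; exact: below_weight_adj.
Qed.

(** Let [A] be minimal with nonzero weight among the cuts that separate the
    ends [u] and [v] of a boundary edge of [A0]: the potential behind [A] is
    nonzero.  As it is zero at [v], there is a next cut [B] on the way to
    [v].  If two nearby vertices [y] and [z] of the outer boundary of [A]
    were outside and inside of [B], then the far end of [A] would be the
    median of [x], [y] and [z] for a neighbour [x] of [y] in [A], contrary
    to [weight0].  By coarse connectedness the whole outer boundary of [A]
    lies outside of [B], so no edge joins [A] to [B `\` A], although [B] is
    connected. *)
Lemma weight_eq0 A0 : N A0 -> (exists x, A0 x) -> (exists y, ~ A0 y) ->
  psi A0 = false.
Proof.
move=> NA0 [x0 A0x0] [y0 nA0y0]; apply/negP => psiA0.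
have [[u v] [/= uv A0u nA0v]] := boundary_nonempty Gconn A0x0 nA0y0.
pose X := [set C | tripod u v v C /\ psi C].
have fX : finite_set X by apply: sub_finite_set (N_finite u v) => C [].
have XA0 : X A0 by split => //; exact/tripodvv.
have [A [[Auv psiA] minA]] := minimal_set fX XA0.
have /tripodvv[NA Au nAv] := Auv.
have sA x : A x -> \big[addb/false]_(C \in below A x) psi C = true.
  move=> Ax; rewrite (below_weight_const NA _ Ax Au); last by exists v.
  rewrite (fsbigD1 A) /=; last 2 first.
  - by apply: sub_finite_set (finite_below u nAv) => C [].
  - by split.
  rewrite psiA fsbig1 // => C [[NC Cu CA] CnA]; apply/negP => psiC_.
  apply: CnA; apply: minA => //; split => //.
  by apply/tripodvv; split => // /CA.
pose X2 := [set C | tripod u v v C /\ A `<` C].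
have fX2 : finite_set X2 by apply: sub_finite_set (N_finite u v) => C [].
have [B0 X2B0] : exists B, X2 B.
  apply: contrapT => noX2.
  have nuv : near d.+1 u v by exact: near_le (near1 uv).
  have := weight0 nuv nuv.
  rewrite /tripod_weight (_ : tripod u v v = below A u) ?sA //.
  apply/seteqP; split => C; last first.
    by move=> [NC Cu CA]; apply/tripodvv; split => // /CA.
  move=> Cuv; have /tripodvv[NC Cu nCv] := Cuv; split => //.
  have [//|AC] := nested_comparable NC NA Cu Au nCv nAv.
  apply: contrapT => nCA; apply: noX2; exists C.
  exact: (conj Cuv (conj AC nCA)).
(* [B] is the successor of [A] in the chain of cuts that separate [u] and
   [v]. *)
have [B [[Buv [AB nBA]] minB]] := minimal_set fX2 X2B0.
have /tripodvv[NB Bu nBv] := Buv.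
have next C : N C -> A `<=` C -> C `<=` B -> C `<=` A \/ C = B.
  move=> NC AC CB; have [|nCA] := pselect (C `<=` A); first by left.
  right; apply: minB => //; apply: conj (conj AC nCA).
  by apply/tripodvv; split => //; [exact: AC | move/CB].
have outB : outer A `<=` ~` B.
  apply: (cb (N_conn NA) (N_conn (N_setC NA))).
    by exists v => //; exists u.
  move=> y z [x Ax [xy nAy]] [_ _ [_ nAz]] nBy yz Bz.
  have nxy : near d.+1 x y by apply: near_le (near1 xy).
  have nxz : near d.+1 x z by rewrite -add1n; exact: near_trans (near1 xy) yz.
  have := weight0 nxy nxz; rewrite /tripod_weight.
  rewrite (_ : tripod x y z = below A x) ?sA //.
  apply/seteqP; split => C; last first.
    by move=> [NC Cx CA]; split => // /CA.
  move=> [NC Cx nCy nCz]; split => //.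
  have [//|AC] := nested_comparable NC NA Cx Ax nCy nAy.
  have [CB|BC] := nested_comparable NC NB Cx (AB _ Ax) nCy nBy.
    by have [//|CB'] := next C NC AC CB; case: nCz; rewrite CB'.
  by case: nCz; exact: BC.
move: nBA => /existsNP[b /not_implyP[Bb nAb]].
have [a [c [Ba Aa Bc nAc ac]]] := conn_boundary (N_conn NB) Bu Au Bb nAb.
by apply: (outB c) => //; exists a.
Qed.

End Weights.

(** * Invariance under automorphisms *)

Section Automorphisms.
Variable G : graph.
Implicit Types (A B C D : set G) (r s : nat -> G) (f g : G -> G).

Definition inverse_automorphisms f g :=
  [/\ cancel f g, cancel g f & forall x y, adj (f x) (f y) = adj x y].

Lemma inverse_automorphisms_sym f g :
  inverse_automorphisms f g -> inverse_automorphisms g f.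
Proof. by move=> [fK gK fadj]; split => // x y; rewrite -fadj !gK. Qed.

Lemma preimageK f g A : cancel f g -> f @^-1` (g @^-1` A) = A.
Proof. by move=> fK; apply/seteqP; split => x /=; rewrite fK. Qed.

Lemma conn_preimage f g A : inverse_automorphisms f g -> conn A ->
  conn (f @^-1` A).
Proof.
move=> [fK gK fadj] cA P [x Ax Px] Pcl y Ay; rewrite -(fK y).
apply: (cA (g @^-1` P)) Ay; first by exists (f x); rewrite //= fK.
move=> a b Aa Ab ab Pa; apply: Pcl Pa; rewrite /= ?gK //.
by rewrite -fadj !gK.
Qed.

Lemma boundary_preimage f g A : inverse_automorphisms f g ->
  boundary (f @^-1` A) = (fun e => (g e.1, g e.2)) @` boundary A.
Proof.
move=> [fK gK fadj]; apply/seteqP; split => [[x y] [/= xy Ax nAy]|].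
  by exists (f x, f y); rewrite /= ?fK //; split; rewrite //= fadj.
by move=> _ [[x y] [/= xy Ax nAy] <-]; split; rewrite /= ?gK // -fadj !gK.
Qed.

Lemma finite_boundary_preimage f g A : inverse_automorphisms f g ->
  finite_set (boundary A) -> finite_set (boundary (f @^-1` A)).
Proof.
by move=> fg fA; rewrite (boundary_preimage _ fg); exact: finite_image.
Qed.

Lemma ncard_boundary_preimage f g A : inverse_automorphisms f g ->
  finite_set (boundary A) ->
  ncard (boundary (f @^-1` A)) = ncard (boundary A).
Proof.
move=> fg fA; rewrite (boundary_preimage _ fg) ncard_image //.
case: fg => fK gK _ [a b] [x y] _ _ /= [].
by move=> /(can_inj gK) -> /(can_inj gK) ->.
Qed.

Lemma bond_preimage n f g A : inverse_automorphisms f g -> bond n A ->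
  bond n (f @^-1` A).
Proof.
move=> fg [cA cA' fA nA]; split.
- exact: conn_preimage fg cA.
- by rewrite preimage_setC; exact: conn_preimage fg cA'.
- exact: finite_boundary_preimage fg fA.
- by rewrite (ncard_boundary_preimage fg).
Qed.

Lemma cross_preimage f g A B : inverse_automorphisms f g -> cross A B ->
  cross (f @^-1` A) (f @^-1` B).
Proof.
move=> [_ gK _].
have lift E : E !=set0 -> (f @^-1` E) !=set0.
  by move=> [x Ex]; exists (g x); rewrite /preimage /= gK.
move=> [/lift h1 /lift h2 /lift h3 /lift h4].
by split; [exact: h1 | exact: h2 | exact: h3 | exact: h4].
Qed.

Lemma crossing_preimage n f g A : inverse_automorphisms f g ->
  crossing n (f @^-1` A) = preimage f @` crossing n A.
Proof.
move=> fg; have gf := inverse_automorphisms_sym fg; have [fK gK _] := fg.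
apply/seteqP; split => [D [bD cD]|_ [D [bD cD] <-]].
  exists (g @^-1` D); last exact: preimageK.
  split; first exact: bond_preimage gf bD.
  by have := cross_preimage gf cD; rewrite (preimageK _ gK).
by split; [exact: bond_preimage fg bD | exact: cross_preimage fg cD].
Qed.

Lemma separating_preimage f g r s A : inverse_automorphisms f g ->
  separating (f \o r) (f \o s) A -> separating r s (f @^-1` A).
Proof.
move=> fg [fA rA sA]; split => //.
exact: finite_boundary_preimage fg fA.
Qed.

Lemma compKray f g r : cancel f g -> g \o (f \o r) = r.
Proof. by move=> fK; apply/funext => n /=; rewrite fK. Qed.

Lemma mincut_preimage f g r s A : inverse_automorphisms f g ->
  mincut (f \o r) (f \o s) A -> mincut r s (f @^-1` A).
Proof.
move=> fg [sA minA]; split; first exact: separating_preimage fg sA.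
have gf := inverse_automorphisms_sym fg; have [fK gK _] := fg.
move=> B sB; have [fB _ _] := sB; have [fA _ _] := sA.
rewrite (ncard_boundary_preimage fg) // -(ncard_boundary_preimage gf fB).
by apply/minA/(separating_preimage gf); rewrite !(compKray _ fK).
Qed.

Lemma ray_comp f g r : inverse_automorphisms f g -> rays G r -> rays G (f \o r).
Proof.
move=> [fK _ fadj] [rI radj]; split => [m n /= /(can_inj fK) /rI //|n /=].
by rewrite fadj.
Qed.

Definition cuts n : set (set G) := [set A | exists r s,
  [/\ rays G r, rays G s & optimal n r s A]].

Lemma cutsC n A : cuts n A -> cuts n (~` A).
Proof.
by move=> [r [s [rr rs oA]]]; exists s, r; split => //; exact: optimalC.
Qed.

Lemma cuts_sides n A : cuts n A -> (exists x, A x) /\ (exists y, ~ A y).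
Proof.
move=> [r [s [_ _ [[[_ /ev_point Ax /ev_point nAy] _] _ _]]]].
by split.
Qed.

Hypothesis Gconn : connected G.

Lemma cuts_bond n A : cuts n A -> bond n A.
Proof. by move=> [r [s [rr rs [mA nA _]]]]; exact: mincut_bond rr rs mA nA. Qed.

Variable d : nat.
Hypotheses (lf : locally_finite G) (cb : coarse_boundaries G d).

Lemma cuts_nested n A B : cuts n A -> cuts n B -> ~ cross A B.
Proof.
move=> [r [s [rr rs oA]]] [r' [s' [rr' rs' oB]]].
exact (optimal_nested Gconn lf cb rr rs rr' rs' oA oB).
Qed.

Lemma cuts_finite n u v : finite_set (tripod (cuts n) u v v).
Proof.
have [R uv] := near_all Gconn u v.
apply: sub_finite_set (finite_bonds_near n R u lf cb).
move=> C /tripodvv[NC Cu nCv]; split; first exact: cuts_bond.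
exact: near_boundary uv Cu nCv.
Qed.

Lemma cuts_preimage n f g A : inverse_automorphisms f g -> cuts n A ->
  cuts n (f @^-1` A).
Proof.
move=> fg [r [s [rr rs [mA nA optA]]]].
have gf := inverse_automorphisms_sym fg; have [fK gK _] := fg.
have fA : finite_set (boundary A) by case: mA => -[].
exists (g \o r), (g \o s).
split; [exact: ray_comp gf rr|exact: ray_comp gf rs|].
have cE (B : set G) h k :
    inverse_automorphisms h k -> finite_set (boundary B) ->
    ncard (crossing n (h @^-1` B)) = ncard (crossing n B).
  move=> hk fB; have [hK kK _] := hk.
  have inj : {in crossing n B &, injective (preimage h)}.
    by move=> C D _ _ E; rewrite -(preimageK C kK) -(preimageK D kK) E.
  rewrite (crossing_preimage _ _ hk) ncard_image //.
  exact (finite_crossing Gconn lf cb n fB).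
split.
- by apply: (mincut_preimage fg); rewrite !(compKray _ gK).
- by rewrite (ncard_boundary_preimage fg).
move=> B mB; rewrite (cE _ _ _ fg fA).
have fB : finite_set (boundary B) by case: mB => -[].
by rewrite -(cE _ _ _ gf fB); apply/optA/(mincut_preimage gf).
Qed.

(** Weights that depend on the size alone are invariant under automorphisms. *)
Lemma tripod_weight_inv n f g (phi : nat -> bool) u v w :
  inverse_automorphisms f g ->
  tripod_weight (cuts n) (fun C => phi (ncard (boundary C))) u v w =
  tripod_weight (cuts n) (fun C => phi (ncard (boundary C))) (f u) (f v) (f w).
Proof.
move=> fg; have gf := inverse_automorphisms_sym fg; have [fK gK _] := fg.
have E : tripod (cuts n) u v w =
    preimage f @` tripod (cuts n) (f u) (f v) (f w).
  apply/seteqP; split => [C [NC Cu nCv nCw]|_ [C [NC Cu nCv nCw] <-]].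
    exists (g @^-1` C); last exact: preimageK.
    by split; rewrite /= /preimage /= ?fK //; exact: (cuts_preimage gf NC).
  by split => //; exact: cuts_preimage fg NC.
rewrite /tripod_weight E fsbig_image; last first.
  move=> C D _ _ CD.
  by rewrite -(preimageK C gK) -(preimageK D gK) CD.
apply: eq_fsbigr => C; rewrite inE => -[NC _ _ _].
by rewrite (ncard_boundary_preimage fg) //; have [] := cuts_bond NC.
Qed.

Lemma near_image f g k x y : inverse_automorphisms f g -> near k x y ->
  near k (f x) (f y).
Proof.
move=> [_ _ fadj] [p [pp lp sp]]; exists (map f p).
split; last by rewrite size_map.
  by rewrite path_map (eq_path (e' := @adj G)).
by rewrite last_map lp.
Qed.

Lemma tripod_representatives k : quasi_transitive G ->
  exists2 T : set (G * (G * G)), finite_set T &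
    forall u v w, near k u v -> near k u w ->
    exists f g, inverse_automorphisms f g /\ T (f u, (f v, f w)).
Proof.
move=> qt; have [[o _]|nov] := pselect (exists o : G, True); last first.
  by exists set0; [exact: finite_set0 | move=> u; case: nov; exists u].
pose rep (c : set G) := xget o [set y | aut_orbit y = c].
pose V := rep @` range (@aut_orbit G).
have fV : finite_set V by exact: finite_image.
pose ball (y : G) := [set v | near k y v].
exists (\bigcup_(y in V) ([set y] `*` (ball y `*` ball y))).
  apply: bigcup_finite => // y _; apply: finite_setX; first exact: finite_set1.
  by apply: finite_setX; exact: finite_ball.
move=> u v w uv uw.
have repu : aut_orbit (rep (aut_orbit u)) = aut_orbit u.
  by apply: (xgetPex o (P := [set y | aut_orbit y = aut_orbit u])); exists u.
have : aut_orbit u u by exists id => //; split => //; exists id.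
rewrite -repu => -[g [[f gK fK] gadj] uE].
have gf : inverse_automorphisms g f by [].
have fg := inverse_automorphisms_sym gf.
exists f, g; split => //.
have -> : f u = rep (aut_orbit u) by rewrite [in LHS]uE gK.
exists (rep (aut_orbit u)); first by exists (aut_orbit u) => //; exists u.
have fu : rep (aut_orbit u) = f u by rewrite [in RHS]uE gK.
by split => //; split => /=; rewrite fu; exact: near_image fg _.
Qed.

Definition mincut_size k := exists r s A,
  [/\ rays G r, rays G s, mincut r s A & ncard (boundary A) = k].

(** Each weighting of the sizes in [ks] by bits gives a bit for each of the
    finitely many triples of representatives.  If there were more sizes than
    triples, two weightings would agree on all triples, and their sum would
    contradict [weight_eq0]. *)
Lemma finitely_many_mincut_sizes : quasi_transitive G ->
  finite_set [set k | mincut_size k].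
Proof.
move=> qt; have [T fT TP] := tripod_representatives d.+1 qt.
apply: contrapT => /infinite_set_fset big.
pose ts : seq _ := fset_set T.
have [K KP Kt] := big (size ts).+1.
pose ks : seq nat := K.
pose n := \max_(k <- ks) k.
(* Sizes outside of [ks] have an index beyond the tuple, hence weight
   [false]. *)
pose phi (b : (size ks).-tuple bool) (k : nat) := nth false b (index k ks).
pose weights b := tripod_weight (cuts n) (fun C => phi b (ncard (boundary C))).
pose W b := map_tuple (fun e => weights b e.1 e.2.1 e.2.2) (in_tuple ts).
have [b1 [b2 [b12 W12]]] : exists b1 b2, b1 <> b2 /\ W b1 = W b2.
  apply: contrapT => inj.
  have /leq_card : injective W.
    by move=> b1 b2 W12; apply: contrapT => b12; apply: inj; exists b1, b2.
  by rewrite !card_tuple card_bool leq_exp2l // leqNgt Kt.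
pose psi C := phi b1 (ncard (boundary C)) (+) phi b2 (ncard (boundary C)).
have zero u v w : near d.+1 u v -> near d.+1 u w ->
    tripod_weight (cuts n) psi u v w = false.
  move=> uv uw; rewrite /tripod_weight fsbig_split; last first.
    apply: (sub_finite_set _ (cuts_finite n u v)) => C [NC Cu nCv _].
    exact/tripodvv.
  have [f [g [fg Tf]]] := TP u v w uv uw.
  have : weights b1 u v w = weights b2 u v w.
    rewrite /weights (tripod_weight_inv n (phi b1) u v w fg).
    rewrite (tripod_weight_inv n (phi b2) u v w fg).
    have ein : (f u, (f v, f w)) \in ts by rewrite in_fset_set // inE.
    have /(congr1 val)/= := W12.
    by move=> /eq_in_map /(_ _ ein).
  by rewrite /weights /tripod_weight => ->; rewrite /= addbb.
have psi0 A : cuts n A -> psi A = false.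
  move=> NA; have [Ax nAy] := cuts_sides NA.
  apply: (weight_eq0 (N := cuts n) (d := d)) => //.
  - by move=> C /cuts_bond[].
  - exact: cutsC.
  - exact: cuts_nested.
  - exact: cuts_finite.
  - by move=> C /cuts_bond[_ _ fC _]; rewrite /psi ncard_boundaryC.
apply: b12; apply: eq_from_tnth => i.
have kin : nth 0 ks i \in ks by rewrite mem_nth.
have [r [s [A [rr rs mA sA]]]] := KP _ kin.
have An : ncard (boundary A) <= n.
  by rewrite sA; apply: (@leq_bigmax_seq _ _ xpredT id).
have [B oB] := optimal_exists mA An.
have sB : ncard (boundary B) = nth 0 ks i.
  rewrite -sA; apply/eqP; rewrite eqn_leq.
  case: oB => -[sepB minB] _ _; case: mA => sepA minA.
  by rewrite minB // minA.
have : psi B = false by apply: psi0; exists r, s.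
rewrite /psi /phi sB index_uniq ?fset_uniq // !(tnth_nth false).
by case: (nth _ _ _); case: (nth _ _ _).
Qed.

End Automorphisms.

(** * Ends and cuts *)

Section Components.
Variable H : graph.
Implicit Types (C D : set H) (x y : H).

Lemma linked_class x y : linked x y ->
  [set z | linked x z] = [set z | linked y z].
Proof.
move=> xy; apply/seteqP; split => z; apply: linked_trans => //.
exact: linked_sym.
Qed.

Lemma components_eq C D x : components H C -> components H D -> C x -> D x ->
  C = D.
Proof.
move=> [a _ <-] [b _ <-] ax bx; apply: linked_class.
exact: linked_trans ax (linked_sym bx).
Qed.

End Components.

Section Ends.
Variable G : graph.
Implicit Types (A B : set G) (F : set (set G)) (r s t : nat -> G).

Lemma ray_equiv_sym r s : ray_equiv r s -> ray_equiv s r.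
Proof. by move=> rs F FE fF; have [C cC []] := rs F FE fF; exists C. Qed.

Lemma ray_equiv_trans s r t : ray_equiv r s -> ray_equiv s t -> ray_equiv r t.
Proof.
move=> rs st F FE fF.
have [C cC [rC sC]] := rs F FE fF; have [D cD [sD tD]] := st F FE fF.
have [x [Cx Dx]] := ev_point (evI sC sD).
by exists C => //; split => //; rewrite (components_eq cC cD Cx Dx).
Qed.

(** From some point on the ray avoids the finitely many edges in [F]. *)
Lemma ray_component F r : rays G r -> finite_set F ->
  exists2 C, components (del_edges F) C & eventually_in r C.
Proof.
move=> [rI radj] fF.
have fX : finite_set [set n | F [set r n; r n.+1]].
  apply: finite_preimage fF => m n _ _ /= E.
  have : [set r m; r m.+1] (r n) by rewrite E; left.
  have : [set r m; r m.+1] (r n.+1) by rewrite E; right.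
  by move=> [] /rI h1 [] /rI h2; move: h1 h2; clear; lia.
have [N NP] := finite_nat_bounded fX.
exists [set y | linked (G := del_edges F) (r N) y]; first by exists (r N).
exists N => n; elim: n => [|n IH].
  by rewrite leqn0 => /eqP <-; exists [::].
rewrite leq_eqVlt => /predU1P[<-|Nn]; first by exists [::].
apply: linked_trans (IH Nn) _; apply: linked_adj.
rewrite /= /del_adj radj /=; apply/negP; rewrite inE => /NP.
by rewrite ltnNge => /negP; apply.
Qed.

Lemma component_boundary_finite F (C : set G) :
  F `<=` edges G -> finite_set F ->
  components (del_edges F) C -> finite_set (boundary C).
Proof.
move=> FE fF [a _ <-].
pose V := \bigcup_(e in F) e.
have fV : finite_set V.
  by apply: bigcup_finite => // e /FE[x [y [_ ->]]]; exact: finite_set2.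
apply: (sub_finite_set _ (finite_setX fV fV)) => -[x y] [/= xy ax nay].
have Fxy : F [set x; y].
  apply: contrapT => nF; apply: nay; apply: linked_trans ax _.
  apply: linked_adj; rewrite /= /del_adj xy /=; apply/negP.
  by rewrite inE.
by split; exists [set x; y] => //; [left|right].
Qed.

Lemma separating_exists r s : rays G r -> rays G s -> ~ ray_equiv r s ->
  exists A, separating r s A.
Proof.
move=> rr rs /existsNP[F /not_implyP[FE /not_implyP[fF no]]].
have [C cC rC] := ray_component rr fF; have [D cD sD] := ray_component rs fF.
exists C; split => //; first exact: component_boundary_finite FE fF cC.
apply: (ev_sub _ sD) => x Dx Cx; apply: no; exists C => //.
by have E := components_eq cC cD Cx Dx; split; [exact: rC | rewrite E].
Qed.

Definition edge_boundary A := (fun e : G * G => [set e.1; e.2]) @` boundary A.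

Lemma edge_boundaryC A : edge_boundary (~` A) = edge_boundary A.
Proof.
suff sub B : edge_boundary (~` B) `<=` edge_boundary B.
  by apply/seteqP; split; first exact: sub; rewrite -{1}(setCK A).
move=> _ [[x y] + <-]; rewrite boundaryC => -[e Be [<- <-]].
by exists e => //=; rewrite setUC.
Qed.

(** Both sides of a bond are components once the boundary edges are deleted. *)
Lemma side_component A a : conn A -> A a ->
  components (del_edges (edge_boundary A)) A.
Proof.
move=> cA Aa; exists a => //; apply/seteqP; split => y /=.
  move=> /linkedE[p pp <-]; elim: p a Aa pp => //= z p IH x Ax /andP[xz].
  apply: IH; apply: contrapT => nAz; move: xz; rewrite /del_adj => /andP[xz].
  by move=> /negP; apply; rewrite inE; exists (x, z).
move: y; apply: (cA (fun y => linked (G := del_edges (edge_boundary A)) a y)).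
  by exists a => //; exists [::].
move=> x y Ax Ay xy ax; apply: linked_trans ax _; apply: linked_adj.
rewrite /= /del_adj xy /=; apply/negP; rewrite inE => -[[u v] [/= uv Au nAv] E].
have : [set x; y] v by rewrite -E; right.
by case=> /= vE; apply: nAv; rewrite vE.
Qed.

Lemma ends_separates A r s : rays G r -> rays G s -> conn A -> conn (~` A) ->
  separating r s A ->
  separates (edge_boundary A) [set t | rays G t /\ ray_equiv r t]
    [set t | rays G t /\ ray_equiv s t].
Proof.
move=> rr rs cA cA' [fA rA sA].
have [a Aa] := ev_point rA; have [b nAb] := ev_point sA.
have compA := side_component cA Aa.
have compA' : components (del_edges (edge_boundary A)) (~` A).
  by rewrite -edge_boundaryC; exact: side_component nAb.
have FE : edge_boundary A `<=` edges G.
  by move=> _ [[x y] [/= xy _ _] <-]; exists x, y.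
have fF : finite_set (edge_boundary A) by exact: finite_image.
exists A, (~` A); split => //.
- by move=> E; move: (Aa); rewrite E; apply.
- move=> t [_ /(_ _ FE fF)[C cC [rC tC]]].
  have [x [Cx Ax]] := ev_point (evI rC rA).
  by rewrite -(components_eq cC compA Cx Ax).
- move=> t [_ /(_ _ FE fF)[C cC [sC tC]]].
  have [x [Cx Ax]] := ev_point (evI sC sA).
  by rewrite -(components_eq cC compA' Cx Ax).
Qed.

Lemma accessible_bounded k : connected G ->
  (forall m, @mincut_size G m -> m < k) -> accessible G.
Proof.
move=> Gconn bound; exists k => _ _ [r rr ->] [s rs ->] neq.
have nrs : ~ ray_equiv r s.
  move=> rs_eq; apply: neq; apply/seteqP; split => t [tt].
    by split => //; apply: ray_equiv_trans (ray_equiv_sym rs_eq) _.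
  by split => //; apply: ray_equiv_trans rs_eq _.
have [A0 sA0] := separating_exists rr rs nrs.
have [A mA] := mincut_exists sA0.
have [fA _ _] := mA.1.
have [cA cA' _ nA] := mincut_bond Gconn rr rs mA (leqnn _).
exists (edge_boundary A); split; last exact: ends_separates mA.1.
  by move=> _ [[x y] [/= xy _ _] <-]; exists x, y.
have fF : finite_set (edge_boundary A) by exact: finite_image.
have /finite_setP[n Fn] := fF.
have nk : n <= k.
  rewrite -(card_fset_set Fn); apply: leq_trans (ncard_image_le _ fA) _.
  by apply/ltnW/bound; exists r, s, A.
by rewrite (card_le_eql Fn) card_le_II.
Qed.

End Ends.

Theorem theorem4p3 (G : graph) :
  locally_finite G -> quasi_transitive G -> hyperbolic G -> accessible G.
Proof.
move=> lf qt hyp; have Gconn : connected G by case: hyp => delta [].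
have [d cb] := outer_coarsely_connected hyp.
have fin := finitely_many_mincut_sizes Gconn lf cb qt.
have [k kP] := finite_nat_bounded fin.
exact: accessible_bounded kP.
Qed.
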